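(* For integers $n\ge1$, $r\ge1$ let $$C_{n,r}:=\frac{\binom{n+r-1}{n}}{\sum_{\substack{k_1,\ldots,k_r\ge 0\\ k_1+\cdots+k_r=n}}\ \prod_{i=1}^r\frac{1}{(k_i+1)!}},$$ the sum being over tuples of nonnegative integers. Then: (I) $$C_{n,r}=\frac{\binom{n+r-1}{n}\,(n+r)!}{S(n+r,r)\,r!},$$ where $S(n+r,r)$ is the Stirling number of the second kind. (II) For every fixed $n\ge1$, the sequence $(C_{n,r})_{r\ge1}$ is non-increasing in $r$, starts at $C_{n,1}=(n+1)!$, and converges to $2^n$; that is, $$(n+1)!=C_{n,1}\ge C_{n,2}\ge\cdots\ge\lim_{r\to\infty}C_{n,r}=2^n.$$
   Context: The Stirling number of the second kind is $S(n+r,r):=\frac{1}{r!}\sum_{j=0}^r(-1)^j\binom{r}{j}(r-j)^{n+r}$. *)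

(* Defs.v *)
From HB Require Import structures.
From mathcomp Require Import all_boot all_order all_algebra.
From mathcomp Require Import all_classical all_reals all_analysis.

Set Implicit Arguments.
Unset Strict Implicit.
Unset Printing Implicit Defensive.

Import Order.TTheory GRing.Theory Num.Theory.
Import numFieldNormedType.Exports.

Local Open Scope ring_scope.

Definition stirling2 (R : realType) (m r : nat) : R :=
  (r`!%:R)^-1 *
    \sum_(j < r.+1) (-1) ^+ j * 'C(r, j)%:R * (r%:R - j%:R) ^+ m.

(* The components of a tuple of naturals summing to n are all at most n, so
   ranging over 'I_n.+1 loses no tuple. *)
Definition comp_sum (R : realType) (n r : nat) : R :=
  \sum_(k : {ffun 'I_r -> 'I_n.+1} | (\sum_(i < r) (k i : nat))%N == n)
    \prod_(i < r) (((k i).+1)`!%:R)^-1.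

Definition Cnr (R : realType) (n r : nat) : R :=
  'C(n + r - 1, n)%:R / comp_sum R n r.

(* Main.v *)
Require Import Defs.
From HB Require Import structures.
From mathcomp Require Import all_boot all_order all_algebra.
From mathcomp Require Import all_classical all_reals all_analysis.
From mathcomp Require Import zify ring lra.
Import Order.TTheory GRing.Theory Num.Theory.
Import numFieldNormedType.Exports.
Local Open Scope classical_set_scope.
Local Open Scope ring_scope.

(** The sum in the denominator of [Cnr R n r] is the coefficient of [x ^ n] in
    [((exp x - 1) / x) ^ r], that is, the coefficient of [x ^ (n + r)] in
    [(exp x - 1) ^ r]. Expanding the latter by the binomial theorem gives
    [r! S(n + r, r) / (n + r)!], hence (I). Only finitely many coefficients
    matter, so the exponential series is replaced by its Taylor polynomials.

    For (II), write [d(n, r)] for [S(n + r, r)]. The recurrence of the Stirling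
    numbers reads [d(n+1, r+1) = (r+1) d(n, r+1) + d(n+1, r)], and everything
    follows from it by double induction on [n] and [r].

    - Monotonicity. By (I), [Cnr R n (r+1) <= Cnr R n r] amounts to
      [(n + r) (n + r + 1) d(n, r) <= r (r + 1) d(n, r+1)]. Replacing
      [d(n, r+1)] by its recurrence turns this into a comparison of [d(n, r)]
      with [d(n-1, r+1)], lemma [stirling2_ratio], in a form that reproduces
      itself in the induction: both sides are expanded by the recurrence and the
      two instances of the induction hypothesis leave a remainder with
      nonnegative coefficients.

    - Limit. Lemmas [stirling2_ge] and [stirling2_le] state that
      [binom(r, n) <= 2^n r! d(n, r) / (n + r)! <= binom(n + r - 1, n)].
      The upper bound says that [Cnr R n r] is at least [2^n]; the lower bound,
      which is the contribution of the tuples with all [k_i <= 1], says that [Cnr R n r]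
      is at most [2^n binom(n + r - 1, n) / binom(r, n)], and this quotient
      of binomials tends to 1. *)

(** * Coefficients of powers of truncated exponential series *)

(** The coefficients of a power up to index [n] only depend on those of the base
    up to index [n]; this makes the truncation order irrelevant. *)
Lemma coef_exp_ext (R : nzRingType) (p q : {poly R}) (n r : nat) :
  (forall i, (i <= n)%N -> p`_i = q`_i) ->
  forall i, (i <= n)%N -> (p ^+ r)`_i = (q ^+ r)`_i.
Proof.
move=> pq; elim: r => [|r IH] i le_in; first by rewrite !expr0.
rewrite !exprS !coefM; apply: eq_bigr => j _.
rewrite pq ?IH //; first exact: leq_trans (leq_subr _ _) le_in.
by apply: leq_trans le_in; rewrite -ltnS.
Qed.

(** The Taylor polynomial of degree [N] of the exponential. *)
Definition exp_trunc (R : realType) (N : nat) : {poly R} :=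
  \poly_(k < N.+1) (k`!%:R)^-1.

(** The Taylor polynomial of degree [N] of [(exp x - 1) / x]. *)
Definition expm1_div_trunc (R : realType) (N : nat) : {poly R} :=
  \poly_(k < N.+1) (k.+1`!%:R)^-1.

Lemma fact_neq0 (R : realType) (n : nat) : n`!%:R != 0 :> R.
Proof. by rewrite pnatr_eq0 -lt0n fact_gt0. Qed.

(** Up to the truncation order, the coefficients are those of [exp (j x)]. *)
Lemma coef_exp_truncX (R : realType) (N j m : nat) : (m <= N)%N ->
  (exp_trunc R N ^+ j)`_m = j%:R ^+ m / m`!%:R.
Proof.
elim: j m => [|j IH] m le_mN.
  rewrite expr0 coef1.
  case: m le_mN => [|m] _; first by rewrite expr0 fact0 invr1 mulr1.
  by rewrite /= expr0n /= mul0r.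
rewrite exprS coefM -natr1 exprDn mulr_suml; apply: eq_bigr => -[i /=].
rewrite ltnS => le_im _.
rewrite coef_poly ltnS (leq_trans le_im le_mN) IH; last first.
  exact: leq_trans (leq_subr _ _) le_mN.
rewrite expr1n mulr1 -(bin_fact le_im) !natrM -mulr_natr.
have bin0 : 'C(m, i)%:R != 0 :> R by rewrite pnatr_eq0 -lt0n bin_gt0.
have i0 := fact_neq0 R i; have mi0 := fact_neq0 R (m - i).
by field; rewrite bin0 i0 mi0.
Qed.

(** Expanding the power by distributivity gives one monomial per tuple [k], of
    degree the sum of the [k i]. *)
Lemma comp_sum_coef (R : realType) (n r N : nat) : (n <= N)%N ->
  comp_sum R n r = (expm1_div_trunc R N ^+ r)`_n.
Proof.
move=> le_nN; rewrite (@coef_exp_ext _ _ (expm1_div_trunc R n) n) //; last first.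
  by move=> i le_in; rewrite !coef_poly !ltnS le_in (leq_trans le_in le_nN).
rewrite /expm1_div_trunc poly_def -[in RHS](card_ord r) -prodr_const.
rewrite bigA_distr_bigA /= coef_sum /comp_sum big_mkcond /=.
apply: eq_bigr => f _.
rewrite scaler_prod prodrXr coefZ coefXn eq_sym.
by case: eqP => _; rewrite ?mulr1 ?mulr0.
Qed.

Lemma exp_trunc_sub1 (R : realType) (N : nat) :
  exp_trunc R N.+1 - 1 = 'X * expm1_div_trunc R N.
Proof.
apply/polyP => i; rewrite coefB coef1 coefXM !coef_poly.
by case: i => [|i] /=; rewrite ?fact0 ?invr1 ?subrr // subr0 ltnS.
Qed.

(** The coefficient of [x ^ (n + r)] in [(exp x - 1) ^ r], computed in two
    ways. *)
Lemma comp_sum_stirling2 (R : realType) (n r : nat) :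
  (n + r)`!%:R * comp_sum R n r = r`!%:R * stirling2 R (n + r) r.
Proof.
rewrite /stirling2 mulVKf ?fact_neq0 // (comp_sum_coef R n r (n + r) (leq_addr r n)).
have -> : (expm1_div_trunc R (n + r) ^+ r)`_n =
          ((exp_trunc R (n + r).+1 - 1) ^+ r)`_(n + r).
  by rewrite exp_trunc_sub1 exprMn coefXnM ltnNge leq_addl addnK.
rewrite exprBn coef_sum mulr_sumr.
apply: eq_bigr => -[j /=]; rewrite ltnS => le_jr _.
rewrite expr1n mulr1 coefMn -(rmorph_sign polyC) coefCM coef_exp_truncX //.
rewrite natrB // -mulr_natr.
by have := fact_neq0 R (n + r) => h; field.
Qed.

(** * Stirling numbers of the second kind *)

Lemma stirling2_n0 (R : realType) (m : nat) : stirling2 R m.+1 0 = 0.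
Proof.
by rewrite /stirling2 big_ord1 subrr expr0n !mulr0.
Qed.

Lemma stirling2_0n (R : realType) (r : nat) : stirling2 R 0 r = (r == 0%N)%:R.
Proof.
rewrite /stirling2.
have -> : \sum_(j < r.+1) (-1) ^+ j * 'C(r, j)%:R * (r%:R - j%:R) ^+ 0 =
          (1 - 1) ^+ r :> R.
  rewrite exprBn; apply: eq_bigr => j _.
  by rewrite expr0 !expr1n !mulr1 mulr_natr.
by rewrite subrr expr0n; case: r => [|r]; rewrite ?mulr0 // fact0 invr1 mulr1.
Qed.

Lemma stirling2_rec (R : realType) (m r : nat) :
  stirling2 R m.+1 r.+1 = r.+1%:R * stirling2 R m r.+1 + stirling2 R m r.
Proof.
(* Absorbing one factor [r + 1 - j] into the binomial lowers it to ['C(r, j)],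
   and Pascal's rule then splits the sum into those for [r + 1] and [r]. *)
have absorb (j : nat) : (j <= r.+1)%N ->
    'C(r.+1, j)%:R * (r.+1%:R - j%:R) = r.+1%:R * 'C(r, j)%:R :> R.
  move=> le_jr; rewrite -natrB // -!natrM; congr (_%:R).
  by rewrite mulnC mul_bin_down.
have main :
    \sum_(j < r.+2) (-1) ^+ j * 'C(r.+1, j)%:R * (r.+1%:R - j%:R) ^+ m.+1 =
    r.+1%:R *
    (\sum_(j < r.+2) (-1) ^+ j * 'C(r.+1, j)%:R * (r.+1%:R - j%:R) ^+ m +
     \sum_(j < r.+1) (-1) ^+ j * 'C(r, j)%:R * (r%:R - j%:R) ^+ m) :> R.
  have -> : \sum_(j < r.+2)
        (-1) ^+ j * 'C(r.+1, j)%:R * (r.+1%:R - j%:R) ^+ m.+1 =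
      r.+1%:R * \sum_(j < r.+2)
        (-1) ^+ j * 'C(r, j)%:R * (r.+1%:R - j%:R) ^+ m :> R.
    rewrite mulr_sumr; apply: eq_bigr => -[j /= lt_jr] _.
    by rewrite exprS mulrA -[X in X * _]mulrA absorb //; ring.
  congr (_ * _); rewrite big_ord_recl [in RHS]big_ord_recl /= !bin0 -addrA.
  congr (_ + _); rewrite -big_split /=; apply: eq_bigr => j _.
  rewrite /bump /= add1n binS natrD exprS.
  have -> : r.+1%:R - j.+1%:R = r%:R - j%:R :> R by rewrite -!natr1; ring.
  by ring.
rewrite /stirling2 main factS natrM.
have := fact_neq0 R r; have : r.+1%:R != 0 :> R by rewrite pnatr_eq0.
by move=> h1 h2; field; rewrite h2 nat1r h1.
Qed.

Lemma stirling2_ge0 (R : realType) (m r : nat) : 0 <= stirling2 R m r.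
Proof.
elim: m r => [|m IH] [|r]; rewrite ?stirling2_0n ?stirling2_n0 ?ler0n //.
by rewrite stirling2_rec (addr_ge0 (mulr_ge0 _ (IH _)) (IH _)) ?ler0n.
Qed.

Lemma stirling2_small (R : realType) (m r : nat) :
  (m < r)%N -> stirling2 R m r = 0.
Proof.
elim: m r => [|m IH] [|r] // lt_mr; first by rewrite stirling2_0n.
by rewrite stirling2_rec !IH ?mulr0 ?addr0 // ltnW.
Qed.

Lemma stirling2_nn (R : realType) (r : nat) : stirling2 R r r = 1.
Proof.
elim: r => [|r IH]; first by rewrite stirling2_0n.
by rewrite stirling2_rec stirling2_small // IH mulr0 add0r.
Qed.

(** The recurrence in terms of the excess [t] of the first index over the
    second. *)
Lemma stirling2_diag_rec (R : realType) (t r : nat) :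
  stirling2 R (t.+1 + r.+1) r.+1 =
  r.+1%:R * stirling2 R (t + r.+1) r.+1 + stirling2 R (t.+1 + r) r.
Proof. by rewrite addSn stirling2_rec addSnnS. Qed.

Lemma stirling2_gt0 (R : realType) (t r : nat) : 0 < stirling2 R (t + r.+1) r.+1.
Proof.
elim: t => [|t IH]; first by rewrite add0n stirling2_nn.
by rewrite stirling2_diag_rec (ltr_wpDr (stirling2_ge0 _ _ _)) // (mulr_gt0 _ IH).
Qed.

(** The comparison of [S(t + 1 + r, r)] with the next Stirling number
    [S(t + 1 + r, r + 1)] behind the monotonicity; it is an equality at
    [t = 0]. *)
Lemma stirling2_ratio (R : realType) (t r : nat) :
  t.+1%:R * (2 * r%:R + t.+2%:R) * stirling2 R (t.+1 + r) r <=
  r%:R * r.+1%:R ^+ 2 * stirling2 R (t + r.+1) r.+1.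
Proof.
elim: t r => [|t IHt]; elim=> [|r IHr].
- by rewrite addn0 stirling2_n0 mulr0 mul0r mul0r.
- move: IHr; rewrite stirling2_diag_rec !add0n !stirling2_nn -!natr1.
  set s := stirling2 R _ r; have : 0 <= r%:R :> R by [].
  by move: r%:R => x x0; nra.
- by rewrite addn0 stirling2_n0 mulr0 mul0r mul0r.
move: IHr (IHt r.+1).
rewrite (stirling2_diag_rec R t r.+1) (stirling2_diag_rec R t.+1 r).
have := stirling2_ge0 R (t.+1 + r.+1) r.+1.
move: (stirling2 R (t + r.+2) r.+2) (stirling2 R (t.+1 + r.+1) r.+1)
  (stirling2 R (t.+2 + r) r) => s1 s0 s_.
rewrite -!natr1.
have : 0 <= r%:R :> R by [].
have : 0 <= t%:R :> R by [].
move: r%:R t%:R => x u u0 x0 s0_ge0 IHr IHt'.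
(* After multiplication by [c], the factor of [s_] in the induction hypothesis
   at [r], the difference of the two sides is a nonnegative combination of the
   differences of the two induction hypotheses and of [s0]. *)
have c_gt0 : 0 < 2 * x + u + 3 by lra.
rewrite -subr_ge0 -(pmulr_lge0 _ c_gt0).
set d := (X in 0 <= X).
have -> : d =
   (2 * x + u + 5) * (x * (x + 1) ^+ 2 * s0
     - (u + 1 + 1) * (2 * x + (u + 1 + 1 + 1)) * s_)
 + (x + 1 + 1) * (2 * x + u + 3) * ((x + 1) * (x + 1 + 1) ^+ 2 * s1
     - (u + 1) * (2 * (x + 1) + (u + 1 + 1)) * s0)
 + (u + 1) * ((2 * x + u + 3) * (u + 2) + x * (x + 1)) * s0.
  by rewrite /d; ring.
rewrite -subr_ge0 in IHr; rewrite -subr_ge0 in IHt'.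
by rewrite !addr_ge0 // mulr_ge0 // ?mulr_ge0 //; nra.
Qed.

(** * Bounds on the Stirling numbers *)

(** [stirling2_diag_rec] for the normalization [2 ^ n * r! * S(n + r, r)] in which
    the bounds below are stated. *)
Lemma stirling2_step (R : realType) (n r : nat) :
  2 ^+ n.+1 * r.+1`!%:R * stirling2 R (n.+1 + r.+1) r.+1 =
  r.+1%:R * (2 * (2 ^+ n * r.+1`!%:R * stirling2 R (n + r.+1) r.+1)
             + 2 ^+ n.+1 * r`!%:R * stirling2 R (n.+1 + r) r).
Proof. by rewrite stirling2_diag_rec factS natrM exprS; ring. Qed.

Lemma stirling2_le (R : realType) (n r : nat) :
  2 ^+ n * r`!%:R * stirling2 R (n + r) r <= 'C(n + r - 1, n)%:R * (n + r)`!%:R.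
Proof.
elim: n r => [|n IHn]; elim=> [|r IHr].
- by rewrite expr0 stirling2_nn bin0 mulr1.
- by rewrite expr0 stirling2_nn bin0 mulr1.
- by rewrite addn0 stirling2_n0 mulr0.
rewrite stirling2_step.
apply: (@le_trans _ _ (r.+1%:R * (2 * ('C(n + r, n)%:R * (n + r).+1`!%:R)
                          + 'C(n + r, n.+1)%:R * (n + r).+1`!%:R))).
  rewrite ler_pM2l // lerD // ?ler_pM2l //.
    by have := IHn r.+1; rewrite addnS subn1.
  by move: IHr; rewrite addSn subn1.
have absorb := mul_bin_left (n + r) n.
rewrite !addSn !addnS subn1 /= [in leRHS]factS binS -!natrM -!natrD -!natrM ler_nat.
rewrite addKn in absorb.
nia.
Qed.

Lemma stirling2_ge (R : realType) (n r : nat) :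
  'C(r, n)%:R * (n + r)`!%:R <= 2 ^+ n * r`!%:R * stirling2 R (n + r) r.
Proof.
elim: n r => [|n IHn]; elim=> [|r IHr].
- by rewrite expr0 stirling2_nn bin0 mulr1.
- by rewrite expr0 stirling2_nn bin0 mulr1.
- by rewrite bin0n mul0r addn0 stirling2_n0 mulr0.
rewrite stirling2_step.
apply: (@le_trans _ _ (r.+1%:R * (2 * ('C(r.+1, n)%:R * (n + r).+1`!%:R)
                          + 'C(r, n.+1)%:R * (n + r).+1`!%:R))); last first.
  rewrite ler_pM2l // lerD // ?ler_pM2l //.
  by have := IHn r.+1; rewrite addnS.
have /= absorb := mul_bin_diag r.+1 n.
have mono : ('C(r, n) <= 'C(r.+1, n))%N by rewrite leq_bin2l.
rewrite !addSn !addnS factS -!natrM -!natrD -!natrM ler_nat.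
rewrite binS in absorb *.
have key : ((n + r).+2 * ('C(r, n.+1) + 'C(r, n)) <=
            r.+1 * (2 * 'C(r.+1, n) + 'C(r, n.+1)))%N.
  by nia.
by have := leq_mul (leqnn (n + r).+1`!) key; lia.
Qed.

(** * The quotients *)

(** Part (I); it holds without restriction on [n] and [r]. *)
Lemma CnrE (R : realType) (n r : nat) :
  Cnr R n r =
    'C(n + r - 1, n)%:R * (n + r)`!%:R / (stirling2 R (n + r) r * r`!%:R).
Proof.
have := comp_sum_stirling2 R n r; have := fact_neq0 R (n + r).
rewrite /Cnr => nr0 eq_cs.
by rewrite [stirling2 _ _ _ * _]mulrC -eq_cs -mulrA invfM mulVKf.
Qed.

Lemma Cnr1 (R : realType) (n : nat) : Cnr R n 1 = (n + 1)`!%:R.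
Proof.
rewrite CnrE addnK binn mul1r factS fact0 muln1 mulr1.
suff -> : stirling2 R (n + 1) 1 = 1 by rewrite divr1.
elim: n => [|n IH]; first by rewrite add0n stirling2_nn.
by rewrite stirling2_diag_rec IH addn0 stirling2_n0 addr0 mulr1.
Qed.

Lemma Cnr_ge (R : realType) (n r : nat) : 2 ^+ n <= Cnr R n r.+1.
Proof.
have f_gt0 : 0 < r.+1`!%:R :> R by rewrite ltr0n fact_gt0.
rewrite CnrE ler_pdivlMr; last exact: mulr_gt0 (stirling2_gt0 R n r) f_gt0.
by rewrite [stirling2 _ _ _ * _]mulrC mulrA stirling2_le.
Qed.

(** Cross-multiplying with [C(n+r+2, n+1) (r+1) = C(n+r+1, n+1) (n+r+2)], both
    sides get the common factor [C(n+r+1, n+1) (n+r+2)! (r+1)!]; what is left is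
    [stirling2_ratio]. *)
Lemma Cnr_step (R : realType) (n r : nat) : Cnr R n.+1 r.+2 <= Cnr R n.+1 r.+1.
Proof.
have s1_gt0 := stirling2_gt0 R n.+1 r.+1.
have s0_gt0 := stirling2_gt0 R n.+1 r.
have f_gt0 k : 0 < k`!%:R :> R by rewrite ltr0n fact_gt0.
rewrite !CnrE ler_pdivrMr; last exact: mulr_gt0.
rewrite mulrAC ler_pdivlMr; last exact: mulr_gt0.
have := stirling2_ratio R n r.+1; move: s1_gt0 s0_gt0.
rewrite (stirling2_diag_rec R n r.+1).
move: (stirling2 R (n + r.+2) r.+2) (stirling2 R (n.+1 + r.+1) r.+1).
move=> s1 s0 _ s0_gt0 ratio.
have absorb : 'C(n.+1 + r.+2 - 1, n.+1)%:R * r.+1%:R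
              = 'C(n.+1 + r.+1 - 1, n.+1)%:R * (n + r.+2)%:R :> R.
  rewrite -!natrM !addSn !addnS !subn1 /=; congr _%:R.
  have /= := mul_bin_down (n + r).+2 n.+1.
  by rewrite (_ : _ - _ = r.+1)%N; [rewrite mulnC => ->; exact: mulnC | lia].
have r1_gt0 : 0 < r.+1%:R :> R by [].
rewrite -(ler_pM2r r1_gt0).
set B := 'C(n.+1 + r.+1 - 1, n.+1)%:R in absorb *.
set F : R := (n.+1 + r.+1)`!%:R.
have -> : (n.+1 + r.+2)`!%:R = (n + r.+3)%:R * F.
  by rewrite -natrM; congr _%:R; rewrite !addSn !addnS factS.
rewrite (factS r.+1) natrM.
rewrite [leLHS](_ : _ = B * F * r.+1`!%:R
  * ((n + r.+2)%:R * (n + r.+3)%:R * s0)); last first.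
  transitivity ('C(n.+1 + r.+2 - 1, n.+1)%:R * r.+1%:R
                * ((n + r.+3)%:R * F) * (s0 * r.+1`!%:R)); first by ring.
  by rewrite absorb; ring.
rewrite [leRHS](_ : _ = B * F * r.+1`!%:R
  * (r.+1%:R * r.+2%:R * (r.+2%:R * s1 + s0))); last by ring.
rewrite ler_wpM2l ?mulr_ge0 ?ler0n //.
move: ratio; rewrite !natrD -!natr1; nra.
Qed.

Lemma Cnr_nonincreasing (R : realType) (n r s : nat) :
  (1 <= n)%N -> (1 <= r)%N -> (r <= s)%N -> Cnr R n s <= Cnr R n r.
Proof.
case: n r s => [|n] [|r] [|s] // _ _; rewrite ltnS => /subnKC <-.
elim: (s - r)%N => [|k IH]; first by rewrite addn0.
by rewrite addnS (le_trans (Cnr_step R n _) IH).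
Qed.

(** The second index is taken at least [n], where the binomial coefficient
    bounding the Stirling number from below is positive. The last factor is
    [((r + 2 n + 1) / (r + 1)) ^ n], an upper bound of the ratio of the falling
    factorials of [n + (r + n) - 1] and [r + n] with [n] factors. *)
Lemma Cnr_le (R : realType) (n r : nat) :
  Cnr R n (r + n) <= 2 ^+ n * (1 + (2 * n)%:R / r.+1%:R) ^+ n.
Proof.
have r1_gt0 : 0 < r.+1%:R :> R by [].
have C_gt0 : 0 < 'C(r + n, n)%:R :> R by rewrite ltr0n bin_gt0 leq_addl.
have f_gt0 k : 0 < k`!%:R :> R by rewrite ltr0n fact_gt0.
have ffact_le m k : (m ^_ k <= m ^ k)%N.
  elim: k m => // k IH [|m] //; rewrite ffactSS expnS leq_mul2l /=.
  rewrite (leq_trans (IH m)) ?orbT //.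
  by case: (k) => // j; rewrite leq_exp2r.
have ffact_ge m k : (m.+1 ^ k <= (m + k) ^_ k)%N.
  elim: k => // k IH; rewrite addnS ffactSS expnS leq_mul //.
  by rewrite ltnS leq_addr.
have bin_le : 'C(n + (r + n) - 1, n)%:R <=
              'C(r + n, n)%:R * (1 + (2 * n)%:R / r.+1%:R) ^+ n :> R.
  rewrite -(ler_pM2r (f_gt0 n)) mulrAC -!natrM !bin_ffact.
  have -> : 1 + (2 * n)%:R / r.+1%:R = (2 * n + r.+1)%:R / r.+1%:R :> R.
    by rewrite natrD mulrDl divff ?gt_eqF // addrC.
  rewrite expr_div_n mulrA ler_pdivlMr ?exprn_gt0 // -!natrX -!natrM ler_nat.
  rewrite mulnC leq_mul // (leq_trans (ffact_le _ _)) //.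
  by case: (n) => // k; rewrite leq_exp2r //; lia.
rewrite CnrE; set s := stirling2 _ _ _.
have low := stirling2_ge R n (r + n); rewrite -/s in low.
have den_gt0 : 0 < s * (r + n)`!%:R.
  have : 0 < 2 ^+ n * (r + n)`!%:R * s by apply: lt_le_trans low; exact: mulr_gt0.
  by rewrite -mulrA pmulr_rgt0 ?exprn_gt0 // mulrC.
rewrite ler_pdivrMr //.
apply: le_trans (ler_wpM2r (ler0n _ _) bin_le) _.
rewrite mulrAC [leRHS](_ : _ = 2 ^+ n * (r + n)`!%:R * s
  * (1 + (2 * n)%:R / r.+1%:R) ^+ n); last by ring.
by apply: ler_wpM2r low; rewrite exprn_ge0 // addr_ge0 // divr_ge0.
Qed.

Lemma Cnr_cvg (R : realType) (n : nat) : Cnr R n r @[r --> \oo] --> (2 ^+ n : R).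
Proof.
rewrite -(cvg_shiftn n.+1).
apply: (@squeeze_cvgr _ _ _ _ (fun=> 2 ^+ n)
  (fun r => 2 ^+ n * (1 + (2 * n)%:R * harmonic r.+1) ^+ n)).
- apply: nearW => r /=; rewrite -[(r + n.+1)%N]addSnnS Cnr_le andbT.
  by rewrite addSn Cnr_ge.
- exact: cvg_cst.
have lim1 : 1 + (2 * n)%:R * @harmonic R r.+1 @[r --> \oo] --> (1 : R).
  rewrite -[X in _ --> X]addr0; apply: cvgD; first exact: cvg_cst.
  rewrite -[X in _ --> X](mulr0 (2 * n)%:R); apply: cvgM; first exact: cvg_cst.
  by rewrite (cvg_shiftS (@harmonic R)); exact: cvg_harmonic.
rewrite -[X in _ --> X]mulr1; apply: cvgM; first exact: cvg_cst.
rewrite -[X in _ --> X](expr1n _ n).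
exact: (cvg_comp _ _ lim1 (@exprn_continuous R n 1)).
Qed.

Theorem lemma4p1 (R : realType) :
  (forall n r : nat, (1 <= n)%N -> (1 <= r)%N ->
     Cnr R n r =
       'C(n + r - 1, n)%:R * (n + r)`!%:R / (stirling2 R (n + r) r * r`!%:R))
  /\
  (forall n : nat, (1 <= n)%N ->
     [/\ Cnr R n 1 = (n + 1)`!%:R,
         forall r s : nat, (1 <= r)%N -> (r <= s)%N -> Cnr R n s <= Cnr R n r,
         forall r : nat, (1 <= r)%N -> 2 ^+ n <= Cnr R n r
       & Cnr R n r @[r --> \oo] --> (2 ^+ n : R)]).
Proof.
split=> [n r _ _|n n_gt0]; first exact: CnrE.
split; [exact: Cnr1 | | by case=> // r _; exact: Cnr_ge | exact: Cnr_cvg].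
by move=> r s r_gt0 le_rs; exact: Cnr_nonincreasing.
Qed.
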